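(* Let $A$ be a real $n\times n$ matrix and let $\Lambda=\mathrm{diag}(\lambda_1,\dots,\lambda_n)$ and $M=\mathrm{diag}(\mu_1,\dots,\mu_n)$ be real diagonal matrices with all $\lambda_k\ne 0$ and all $\mu_k\neq 0$. Then there exists a nonzero $x\in\mathbb{R}^n$ with $(A^T\Lambda^{-1}A-M)x=0$ if and only if there exists a nonzero $y\in\mathbb{R}^n$ with $(AM^{-1}A^T-\Lambda)y=0$. *)

(* Defs.v *)
From mathcomp Require Import all_boot all_order all_algebra reals.

(* Main.v *)
Require Import Defs.
From mathcomp Require Import all_boot all_order all_algebra reals.
Import GRing.Theory.
Local Open Scope ring_scope.

(** Up to sign, both matrices are Schur complements of the block matrix with rows [M], [A^T] and
    [A], [Lambda], so one is singular exactly when the other is. [schur_kernel_transfer] makes this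
    explicit by carrying a kernel vector across. *)

Lemma diag_mx_unit (F : fieldType) (n : nat) (d : 'rV[F]_n) :
  (forall k, d 0 k != 0) -> diag_mx d \in unitmx.
Proof.
by move=> d_neq0; rewrite unitmxE det_diag unitfE; apply/prodf_neq0 => i _.
Qed.

(* If [B L^-1 A x = M x], then [y := L^-1 A x] satisfies
   [A M^-1 B y = A x = L y], and [y = 0] would force [M x = B y = 0]. *)
Lemma schur_kernel_transfer (F : comUnitRingType) (m n : nat)
    (L : 'M[F]_m) (M : 'M[F]_n) (A : 'M[F]_(m, n)) (B : 'M[F]_(n, m)) :
    L \in unitmx -> M \in unitmx ->
  (exists x : 'cV[F]_n, x != 0 /\ (B *m invmx L *m A - M) *m x = 0) ->
  exists y : 'cV[F]_m, y != 0 /\ (A *m invmx M *m B - L) *m y = 0.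
Proof.
move=> L_unit M_unit [x [x_neq0 /eqP]].
rewrite mulmxBl subr_eq0 -!mulmxA => /eqP By_eq.
exists (invmx L *m (A *m x)); split.
  apply: contraNneq x_neq0 => y_eq0.
  by rewrite -(mulKmx M_unit x) -By_eq y_eq0 !mulmx0.
by rewrite mulmxBl -!mulmxA By_eq mulKmx // mulKVmx // subrr.
Qed.

Theorem mainTheorem2 (R : realType) (n : nat) (A : 'M[R]_n)
    (lambda mu : 'rV[R]_n)
    (lambda_neq0 : forall k : 'I_n, lambda 0 k != 0)
    (mu_neq0 : forall k : 'I_n, mu 0 k != 0) :
  let Lambda := diag_mx lambda in
  let M := diag_mx mu in
  (exists x : 'cV[R]_n,
      x != 0 /\ (A^T *m invmx Lambda *m A - M) *m x = 0) <->
  (exists y : 'cV[R]_n,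
      y != 0 /\ (A *m invmx M *m A^T - Lambda) *m y = 0).
Proof.
(* The converse is the same transfer with [Lambda] and [M] exchanged, and [A] and [A^T]
   exchanged. *)
by move=> Lambda M; split; apply: schur_kernel_transfer; apply: diag_mx_unit.
Qed.
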